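(* Let $M,N\ge1$ be integers, $P,\sigma^2,\beta_1,\beta_2,\alpha_{\max}>0$, $\varphi_1\in\mathbb{R}$, let $\mathbf{a}_{2,1}\in\mathbb{C}^M$ have unit-modulus entries, let $\mathbf{h}_3\in\mathbb{C}^M$, and put $x=\mathbf{h}_3^{H}\mathbf{a}_{2,1}e^{\mathsf{j}\varphi_1}$. Let $\alpha_{\rm A\text{-}RIS}\in(0,\alpha_{\max}]$ be the optimal active-RIS amplitude defined in the context. For $\alpha\ge0$ define $$\mathrm{SNR}_{\rm NCR}(\alpha)=\frac{P\alpha^2M\beta_1\beta_2-P\alpha^2\beta_2|x|^2+2P\alpha\sqrt{\beta_1\beta_2}\,\Re(x)}{\sigma^2(1+\alpha^2\beta_2M)}+\frac{P\|\mathbf{h}_3\|^2}{\sigma^2},$$ and let $$g=\frac{\alpha_{\rm A\text{-}RIS}^2M\beta_1\beta_2N^2-\alpha_{\rm A\text{-}RIS}^2\beta_2N|x|^2+2\alpha_{\rm A\text{-}RIS}N\sqrt{\beta_1\beta_2}\,|x|}{1+\alpha_{\rm A\text{-}RIS}^2\beta_2MN},\qquad \mathrm{SNR}_{\rm A\text{-}RIS}=\frac{P}{\sigma^2}\left(g+\|\mathbf{h}_3\|^2\right),$$ $$\mathcal{A}=M\beta_1\beta_2-|x|^2\beta_2-\beta_2Mg,\qquad \mathcal{B}=2\Re(x)\sqrt{\beta_1\beta_2},\qquad \mathcal{C}=-g.$$ Say that the repeater with gain $\alpha\ge0$ outperforms the active RIS if $\mathrm{SNR}_{\rm NCR}(\alpha)\ge\mathrm{SNR}_{\rm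 A\text{-}RIS}$. This holds if and only if $\mathcal{A}\alpha^2+\mathcal{B}\alpha+\mathcal{C}\ge0$. Moreover: (1) If $\mathcal{A}>0$ and $\alpha>\frac{-\mathcal{B}+\sqrt{\mathcal{B}^2-4\mathcal{A}\mathcal{C}}}{2\mathcal{A}}$, the repeater outperforms the active RIS. (2) Suppose $\mathcal{A}=0$. If $\Re(x)\le0$, the repeater does not outperform the active RIS for any $\alpha\ge0$. If $\Re(x)>0$ and $\alpha>-\mathcal{C}/\mathcal{B}$, the repeater outperforms the active RIS. (3) Suppose $\mathcal{A}<0$. If $\Re(x)\le0$, the repeater does not outperform the active RIS for any $\alpha\ge0$. If $\Re(x)>0$ and $\mathcal{B}^2-4\mathcal{A}\mathcal{C}\ge0$, the repeater outperforms the active RIS whenever $$\alpha\in\left(\frac{-\mathcal{B}+\sqrt{\mathcal{B}^2-4\mathcal{A}\mathcal{C}}}{2\mathcal{A}},\ \frac{-\mathcal{B}-\sqrt{\mathcal{B}^2-4\mathcal{A}\mathcal{C}}}{2\mathcal{A}}\right).$$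
   Context: $\mathsf{j}$ is the imaginary unit, $(\cdot)^H$ is the conjugate transpose, $\Re$ is the real part, and $\|\cdot\|$ is the Euclidean norm. The optimal active-RIS amplitude is $\alpha_{\rm A\text{-}RIS}=\alpha_{\max}$ if $x=0$, and otherwise $\alpha_{\rm A\text{-}RIS}=\min(\alpha^\star,\alpha_{\max})$ with $$\alpha^\star=\frac{A_0\sigma^2+\sqrt{A_0^2\sigma^4+B_0^2C_0\sigma^2}}{B_0C_0},$$ where $A_0=PM\beta_1\beta_2N^2-P\beta_2N|x|^2$, $B_0=2PN\sqrt{\beta_1\beta_2}\,|x|$, $C_0=\sigma^2\beta_2MN$. The two SNRs are the uplink signal-to-noise ratios, in the presence of a direct user–base-station channel $\mathbf{h}_3$, with a network-controlled repeater (NCR) of gain $\alpha$ and with an optimally configured active RIS with $N$ elements (maximum per-element gain $\alpha_{\max}$), respectively. *)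

(* Defs.v *)
From HB Require Import structures.
From mathcomp Require Export all_boot all_order all_algebra.
From mathcomp Require Export complex.
From mathcomp Require Export reals trigo.

Set Implicit Arguments.
Unset Strict Implicit.
Unset Printing Implicit Defensive.

Import Order.TTheory GRing.Theory Num.Theory.

Local Open Scope ring_scope.
Local Open Scope complex_scope.

(* The library's norm on R[i] takes values in R[i]; [cabs] is R-valued. *)
Notation cabs := ComplexField.Normc.normc.

Definition expj {R : realType} (t : R) : R[i] := cos t +i* sin t.

(* The Euclidean norm, as opposed to the library's sup norm on matrices. *)
Definition enorm {R : realType} {M : nat} (h : 'cV[R[i]]_M) : R :=
  Num.sqrt (\sum_(m < M) cabs (h m 0) ^+ 2).

(* For positive parameters this lies in ]0, alpha_max]: B0 and C0 are positive
   when x != 0, and then so is alpha_star, whatever the sign of A0. *)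
Definition aris_amplitude {R : realType} (M N : nat)
    (P sigma beta1 beta2 alpha_max : R) (x : R[i]) : R :=
  let A0 := P * M%:R * beta1 * beta2 * N%:R ^+ 2
            - P * beta2 * N%:R * cabs x ^+ 2 in
  let B0 := 2 * P * N%:R * Num.sqrt (beta1 * beta2) * cabs x in
  let C0 := sigma ^+ 2 * beta2 * M%:R * N%:R in
  let alpha_star :=
    (A0 * sigma ^+ 2
     + Num.sqrt (A0 ^+ 2 * sigma ^+ 4 + B0 ^+ 2 * C0 * sigma ^+ 2))
    / (B0 * C0) in
  if x == 0 then alpha_max else Num.min alpha_star alpha_max.

Definition snr_ncr {R : realType} (M : nat) (P sigma beta1 beta2 : R)
    (h3 : 'cV[R[i]]_M) (x : R[i]) (alpha : R) : R :=
  (P * alpha ^+ 2 * M%:R * beta1 * beta2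
   - P * alpha ^+ 2 * beta2 * cabs x ^+ 2
   + 2 * P * alpha * Num.sqrt (beta1 * beta2) * complex.Re x)
  / (sigma ^+ 2 * (1 + alpha ^+ 2 * beta2 * M%:R))
  + P * enorm h3 ^+ 2 / sigma ^+ 2.

Definition aris_gain {R : realType} (M N : nat)
    (beta1 beta2 : R) (x : R[i]) (alpha : R) : R :=
  (alpha ^+ 2 * M%:R * beta1 * beta2 * N%:R ^+ 2
   - alpha ^+ 2 * beta2 * N%:R * cabs x ^+ 2
   + 2 * alpha * N%:R * Num.sqrt (beta1 * beta2) * cabs x)
  / (1 + alpha ^+ 2 * beta2 * M%:R * N%:R).

Definition snr_aris {R : realType} (M : nat) (P sigma : R)
    (h3 : 'cV[R[i]]_M) (g : R) : R :=
  P / sigma ^+ 2 * (g + enorm h3 ^+ 2).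

(* Main.v *)
Require Import Defs.
From mathcomp Require Import all_boot all_order all_algebra.
From mathcomp Require Import complex reals trigo.
From mathcomp Require Import ring lra.

Set Implicit Arguments.
Unset Strict Implicit.
Unset Printing Implicit Defensive.

Import Order.TTheory GRing.Theory Num.Theory.

Local Open Scope ring_scope.
Local Open Scope complex_scope.
Local Open Scope sesquilinear_scope.

(* Outperforming is the sign condition [A alpha^2 + B alpha + C >= 0].  The
   positive claims are settled by completing the square (or directly, if [A = 0]);
   the negative ones hold as soon as [C < 0], i.e. the active RIS has a positive
   gain.  Write this gain as [alpha (a alpha + b) / (1 + c alpha^2)]; [b] is
   nonnegative, but [a] may be negative.  If [x = 0] then [a > 0]; otherwise
   [b > 0] and the optimal amplitude is at most
   [alpha* = (a + sqrt (a^2 + b^2 c)) / (b c)], which for [a < 0] lies below the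
   positive zero [- b / a] of the gain. *)

Section Quadratic.
Variable R : rcfType.
Implicit Types a b c e t : R.

(** The factor [4 * a] avoids dividing by [a]: its sign alone decides whether the square must lie
    above or below the discriminant. *)
Lemma four_mul_quadratic a b c t :
  4 * a * (a * t ^+ 2 + b * t + c) = (2 * a * t + b) ^+ 2 - (b ^+ 2 - 4 * a * c).
Proof. by ring. Qed.

Lemma quadratic_gt0_right a b c t : 0 < a ->
  (- b + Num.sqrt (b ^+ 2 - 4 * a * c)) / (2 * a) < t ->
  0 < a * t ^+ 2 + b * t + c.
Proof.
move=> a0; rewrite ltr_pdivrMr ?mulr_gt0 // => ht.
have a4 : 0 < 4 * a by rewrite mulr_gt0.
rewrite -(pmulr_rgt0 _ a4) four_mul_quadratic subr_gt0.
have hs : Num.sqrt (b ^+ 2 - 4 * a * c) < 2 * a * t + b by lra.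
(* Comparing square roots also covers a negative discriminant, whose [Num.sqrt] is 0: only the
   larger side has to be positive. *)
by rewrite -ltr_sqrt ?sqrtr_sqr ?(lt_le_trans hs (ler_norm _)) //
  exprn_gt0 // (le_lt_trans (sqrtr_ge0 _) hs).
Qed.

Lemma quadratic_gt0_between a b c t : a < 0 ->
  (- b + Num.sqrt (b ^+ 2 - 4 * a * c)) / (2 * a) < t ->
  t < (- b - Num.sqrt (b ^+ 2 - 4 * a * c)) / (2 * a) ->
  0 < a * t ^+ 2 + b * t + c.
Proof.
move=> a0; have a2 : 2 * a < 0 by lra.
rewrite ltr_ndivrMr // ltr_ndivlMr // => ht1 ht2.
have a4 : 4 * a < 0 by lra.
rewrite -(nmulr_rlt0 _ a4) four_mul_quadratic subr_lt0.
(* Division by [2 * a < 0] swaps the two bounds; together they bound the absolute value. *)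
have hs : `|2 * a * t + b| < Num.sqrt (b ^+ 2 - 4 * a * c).
  by rewrite ltr_norml; apply/andP; split; lra.
have D0 : 0 < b ^+ 2 - 4 * a * c.
  by rewrite -sqrtr_gt0 (le_lt_trans (normr_ge0 _) hs).
by rewrite -ltr_sqrt ?sqrtr_sqr.
Qed.

(** Makes [a + Num.sqrt (a ^+ 2 + e)] positive for either sign of [a]; both the positivity of the
    optimum and that of the gain there rest on this. *)
Lemma normr_lt_sqrt_sqrD a e : 0 < e -> `|a| < Num.sqrt (a ^+ 2 + e).
Proof.
move=> e0; rewrite -sqrtr_sqr ltr_sqrt ?ltrDl //.
by rewrite ltr_wpDl ?sqr_ge0.
Qed.

Lemma affine_gt0_of_le_optimum a b c t : 0 < b -> 0 < c -> 0 <= t ->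
  t <= (a + Num.sqrt (a ^+ 2 + b ^+ 2 * c)) / (b * c) ->
  0 < a * t + b.
Proof.
move=> b0 c0 t0 ht; have [a0|a0] := leP 0 a.
  by rewrite ltr_wpDl // mulr_ge0.
set s := Num.sqrt _ in ht.
have bc0 : 0 < b * c by rewrite mulr_gt0.
have bbc0 : 0 < b ^+ 2 * c by rewrite mulr_gt0 ?exprn_gt0.
have ss : s ^+ 2 = a ^+ 2 + b ^+ 2 * c.
  by rewrite sqr_sqrtr // addr_ge0 ?sqr_ge0 ?ltW.
have sa : - a < s.
  by rewrite -(ltr0_norm a0) normr_lt_sqrt_sqrD.
(* The value at the optimum: over the denominator [b * c] the numerator is
   [a ^+ 2 + a * s + b ^+ 2 * c], that is [s ^+ 2 + a * s]. *)
have h : a * ((a + s) / (b * c)) + b = s * (s + a) / (b * c).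
  rewrite mulrDr -expr2 ss; field.
  by rewrite (gt_eqF b0) (gt_eqF c0).
apply: (@lt_le_trans _ _ (a * ((a + s) / (b * c)) + b)).
  by rewrite h divr_gt0 // mulr_gt0 //; lra.
(* For [a < 0] the affine function decreases, so its value at [t] is at least the one at the
   optimum. *)
by rewrite lerD2r ler_wnM2l // ltW.
Qed.

End Quadratic.

Section Gain.
Variables (R : realType) (M N : nat) (beta1 beta2 : R) (x : R[i]).
Hypotheses (M_gt0 : (0 < M)%N) (N_gt0 : (0 < N)%N).
Hypotheses (beta1_gt0 : 0 < beta1) (beta2_gt0 : 0 < beta2).

Let a := M%:R * beta1 * beta2 * N%:R ^+ 2 - beta2 * N%:R * cabs x ^+ 2.
Let b := 2 * N%:R * Num.sqrt (beta1 * beta2) * cabs x.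
Let c := beta2 * M%:R * N%:R.

Lemma aris_gainE t :
  aris_gain M N beta1 beta2 x t = t * (a * t + b) / (1 + t ^+ 2 * c).
Proof. by rewrite /aris_gain /a /b /c; congr (_ / _); ring. Qed.

(** Since [A0 = P * a], [B0 = P * b] and [C0 = sigma ^+ 2 * c], the factor [P * sigma ^+ 2] comes
    out of the root and cancels, leaving only the coefficients of the gain. *)
Lemma aris_amplitudeE (P sigma alpha_max : R) :
  0 < P -> 0 < sigma ^+ 2 -> x != 0 ->
  aris_amplitude M N P sigma beta1 beta2 alpha_max x =
  Num.min ((a + Num.sqrt (a ^+ 2 + b ^+ 2 * c)) / (b * c)) alpha_max.
Proof.
move=> P0 s0 x0; rewrite /aris_amplitude (negPf x0); congr (Num.min _ _).
set A0 := P * _ * _ * _ * _ - _; set B0 := 2 * P * _ * _ * _.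
set C0 := sigma ^+ 2 * _ * _ * _.
have -> : A0 = P * a by rewrite /A0 /a; ring.
have -> : B0 = P * b by rewrite /B0 /b; ring.
have -> : C0 = sigma ^+ 2 * c by rewrite /C0 /c; ring.
have -> : (P * a) ^+ 2 * sigma ^+ 4 + (P * b) ^+ 2 * (sigma ^+ 2 * c) * sigma ^+ 2
  = (P * sigma ^+ 2) ^+ 2 * (a ^+ 2 + b ^+ 2 * c) by ring.
rewrite sqrtrM ?sqr_ge0 // sqrtr_sqr ger0_norm; last by rewrite mulr_ge0 ?ltW.
have -> : P * a * sigma ^+ 2 + P * sigma ^+ 2 * Num.sqrt (a ^+ 2 + b ^+ 2 * c)
  = P * sigma ^+ 2 * (a + Num.sqrt (a ^+ 2 + b ^+ 2 * c)) by ring.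
have -> : P * b * (sigma ^+ 2 * c) = P * sigma ^+ 2 * (b * c) by ring.
by rewrite -mulf_div divff ?mul1r // gt_eqF // mulr_gt0.
Qed.

Lemma aris_gain_gt0 (P sigma alpha_max : R) :
  0 < P -> 0 < sigma ^+ 2 -> 0 < alpha_max ->
  0 < aris_gain M N beta1 beta2 x
        (aris_amplitude M N P sigma beta1 beta2 alpha_max x).
Proof.
move=> P0 s0 am0; have M0 : 0 < M%:R :> R by rewrite ltr0n.
have N0 : 0 < N%:R :> R by rewrite ltr0n.
have c0 : 0 < c by rewrite !mulr_gt0.
set t := aris_amplitude _ _ _ _ _ _ _ _.
suff [t0 ht] : 0 < t /\ 0 < a * t + b.
  rewrite aris_gainE divr_gt0 ?mulr_gt0 //.
  by rewrite addr_gt0 // mulr_gt0 // exprn_gt0.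
have [x0|x0] := eqVneq x 0.
  have tE : t = alpha_max by rewrite /t /aris_amplitude x0 eqxx.
  have cx0 : cabs x = 0 by rewrite x0 ComplexField.Normc.normc0.
  rewrite tE; split=> //; rewrite /a /b cx0 expr0n /= !mulr0 subr0 addr0.
  by rewrite !mulr_gt0 // exprn_gt0.
have cx0 : 0 < cabs x.
  by rewrite lt_def (_ : 0 <= cabs x) ?andbT;
    [apply: contra x0 => /eqP /ComplexField.Normc.eq0_normc ->
    |case: (x) => *; exact: sqrtr_ge0].
have sb0 : 0 < Num.sqrt (beta1 * beta2) by rewrite sqrtr_gt0 mulr_gt0.
have b0 : 0 < b by rewrite !mulr_gt0.
have t0 : 0 < t.
  rewrite /t aris_amplitudeE // lt_min am0 andbT divr_gt0 ?mulr_gt0 //.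
  have : `|a| < Num.sqrt (a ^+ 2 + b ^+ 2 * c).
    by rewrite normr_lt_sqrt_sqrD // mulr_gt0 ?exprn_gt0.
  (* Positivity of the numerator, from [- a <= |a|]. *)
  by rewrite -ltrBlDl sub0r; apply: le_lt_trans; rewrite -normrN ler_norm.
split=> //; apply: (affine_gt0_of_le_optimum b0 c0 (ltW t0)).
by rewrite /t aris_amplitudeE // ge_min lexx.
Qed.

(** The direct-channel terms cancel in the difference of the SNRs, and clearing the positive
    denominator leaves the quadratic. *)
Lemma snr_aris_le_snr_ncr (P sigma g alpha : R) (h3 : 'cV[R[i]]_M) :
  0 < P -> 0 < sigma ^+ 2 ->
  (snr_aris P sigma h3 g <= snr_ncr P sigma beta1 beta2 h3 x alpha) =
  (0 <= (M%:R * beta1 * beta2 - cabs x ^+ 2 * beta2 - beta2 * M%:R * g)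
          * alpha ^+ 2
        + 2 * complex.Re x * Num.sqrt (beta1 * beta2) * alpha - g).
Proof.
move=> P0 s0; set q := (X in _ = (0 <= X)).
have sigma0 : sigma != 0.
  by rewrite -sqrf_eq0 gt_eqF.
have d0 : 0 < 1 + alpha ^+ 2 * beta2 * M%:R.
  by rewrite ltr_wpDr // (mulr_ge0 _ (ler0n _ _)) // (mulr_ge0 (sqr_ge0 _)) // ltW.
rewrite -subr_ge0.
have -> : snr_ncr P sigma beta1 beta2 h3 x alpha - snr_aris P sigma h3 g
  = P / (sigma ^+ 2 * (1 + alpha ^+ 2 * beta2 * M%:R)) * q.
  rewrite /snr_ncr /snr_aris /q; field.
  by rewrite (gt_eqF d0) sigma0.
by rewrite pmulr_rge0 // divr_gt0 // mulr_gt0.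
Qed.

End Gain.

Theorem mainTheorem13 (R : realType) (M N : nat) (hM : (1 <= M)%N)
  (hN : (1 <= N)%N) (P sigma beta1 beta2 alpha_max phi1 : R)
  (hP : 0 < P) (hsigma : 0 < sigma ^+ 2) (hbeta1 : 0 < beta1)
  (hbeta2 : 0 < beta2) (halpha_max : 0 < alpha_max)
  (a21 h3 : 'cV[R[i]]_M) (ha21 : forall m : 'I_M, `|a21 m 0| = 1) :
  let x := (h3 ^t* *m a21) 0 0 * expj phi1 in
  let alpha_aris := aris_amplitude M N P sigma beta1 beta2 alpha_max x in
  let g := aris_gain M N beta1 beta2 x alpha_aris in
  let A := M%:R * beta1 * beta2 - cabs x ^+ 2 * beta2 - beta2 * M%:R * g in
  let B := 2 * complex.Re x * Num.sqrt (beta1 * beta2) in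
  let C := - g in
  let outperforms := fun alpha : R =>
    snr_ncr P sigma beta1 beta2 h3 x alpha >= snr_aris P sigma h3 g in
  (forall alpha : R, 0 <= alpha ->
     (outperforms alpha <-> A * alpha ^+ 2 + B * alpha + C >= 0)) /\
  (0 < A -> forall alpha : R, 0 <= alpha ->
     alpha > (- B + Num.sqrt (B ^+ 2 - 4 * A * C)) / (2 * A) ->
     outperforms alpha) /\
  (A = 0 ->
     (complex.Re x <= 0 -> forall alpha : R, 0 <= alpha ->
        ~ outperforms alpha) /\
     (0 < complex.Re x -> forall alpha : R, 0 <= alpha ->
        alpha > - C / B -> outperforms alpha)) /\
  (A < 0 ->
     (complex.Re x <= 0 -> forall alpha : R, 0 <= alpha ->
        ~ outperforms alpha) /\
     (0 < complex.Re x -> B ^+ 2 - 4 * A * C >= 0 ->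
        forall alpha : R, 0 <= alpha ->
        (- B + Num.sqrt (B ^+ 2 - 4 * A * C)) / (2 * A) < alpha ->
        alpha < (- B - Num.sqrt (B ^+ 2 - 4 * A * C)) / (2 * A) ->
        outperforms alpha)).
Proof.
move=> x alpha_aris g A B C outperforms.
have g0 : 0 < g by exact: aris_gain_gt0.
have outE alpha : outperforms alpha = (0 <= A * alpha ^+ 2 + B * alpha + C) :> bool.
  exact: snr_aris_le_snr_ncr.
have beta0 : 0 < Num.sqrt (beta1 * beta2) by rewrite sqrtr_gt0 mulr_gt0.
(* Here [B] has the sign of [Re x], so the first two terms are nonpositive, while [C = - g] is
   strictly negative. This serves both [A = 0] and [A < 0]. *)
have not_out alpha : A <= 0 -> complex.Re x <= 0 -> 0 <= alpha ->
    ~ outperforms alpha.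
  move=> A0 x0 alpha0; apply/negP; rewrite outE -ltNge.
  have B0 : B <= 0 by rewrite pmulr_lle0 // pmulr_rle0.
  have := mulr_le0_ge0 A0 (sqr_ge0 alpha).
  by have := mulr_le0_ge0 B0 alpha0; rewrite /C; lra.
split; first by move=> alpha _; rewrite outE.
split; first by move=> A0 alpha _ h; rewrite outE ltW // quadratic_gt0_right.
split=> A0; split=> x0.
- by move=> alpha; apply: not_out; rewrite ?A0.
- have B0 : 0 < B by rewrite !mulr_gt0.
  by move=> alpha _; rewrite outE A0 ltr_pdivrMr // => h; lra.
- by move=> alpha; apply: not_out => //; apply: ltW.
- by move=> _ alpha _ h1 h2; rewrite outE ltW // quadratic_gt0_between.
Qed.
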